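(* Let $\ell\ge3$ and $n\ge 1$ be integers, and write $n=(\ell-1)q+r$ with integers $q\ge0$ and $0\le r<\ell-1$. Then $$\operatorname{ex}_2^+(n,\overrightarrow C_\ell)=\sum_{i=1}^{q}(\ell-1)\big((\ell-1)(q-i+1)-1+r\big)^2+\begin{cases} r(r-1)^2,& r>0,\\ 0,& r=0.\end{cases}$$ In particular, $\operatorname{ex}_2^+(n,\overrightarrow C_3)=\dfrac{n(n^2-1)}{3}$.
   Context: Digraphs are finite and loopless; digons (pairs of opposite arcs on the same two vertices) are allowed. $\overrightarrow C_\ell$ is the directed cycle of length $\ell$. A digraph is $F$-free if it contains no (not necessarily induced) subdigraph isomorphic to $F$. With $d_D^+(v)$ the out-degree, $$\operatorname{ex}_2^+(n,F)=\max\Big\{\sum_{v\in V(D)}d_D^+(v)^2 : |V(D)|=n,\ D\text{ is }F\text{-free}\Big\}.$$ *)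

(* Defs.v *)
From mathcomp Require Import all_boot.
Set Implicit Arguments.
Unset Strict Implicit.
Unset Printing Implicit Defensive.

Record digraph := Digraph {
  vertex :> finType;
  arc : rel vertex;
  arc_irr : irreflexive arc
}.

Definition outdeg (D : digraph) (v : D) : nat := #|[set w : D | arc v w]|.

Definition sum_sq_outdeg (D : digraph) : nat := \sum_(v : D) outdeg v ^ 2.

Definition contains (F D : digraph) : bool :=
  [exists f : {ffun F -> D},
    injectiveb f && [forall u : F, forall v : F, arc u v ==> arc (f u) (f v)]].

Definition free (F D : digraph) : bool := ~~ contains F D.

Definition loopless (n : nat) (A : {set 'I_n * 'I_n}) : bool :=
  [forall v : 'I_n, (v, v) \notin A].

Definition arc_set (n : nat) := {A : {set 'I_n * 'I_n} | loopless A}.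

Lemma arc_set_irr (n : nat) (A : arc_set n) :
  irreflexive (fun u v : 'I_n => (u, v) \in val A).
Proof. by move=> v; apply: negbTE; apply: (forallP (valP A)). Qed.

Definition digraph_of (n : nat) (A : arc_set n) : digraph :=
  Digraph (arc_set_irr A).

(* The maximum ranges over the labelled digraphs on 'I_n, which represent all
   digraphs on n vertices up to isomorphism; [ex2_ub] and [ex2_attained] show
   that it is the maximum over all F-free digraphs on n vertices. It is 0 when
   there is no such digraph. *)
Definition ex2 (n : nat) (F : digraph) : nat :=
  \max_(A : arc_set n | free F (digraph_of A)) sum_sq_outdeg (digraph_of A).

(* [ordS i] is i + 1 modulo l. The conjunct i != j only matters for l = 1,
   where [ordS] would give a loop. *)
Definition dicycle_arc (l : nat) (i j : 'I_l) : bool :=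
  (i != j) && (j == ordS i).

Lemma dicycle_arc_irr (l : nat) : irreflexive (@dicycle_arc l).
Proof. by move=> i; rewrite /dicycle_arc eqxx. Qed.

Definition dicycle (l : nat) : digraph := Digraph (@dicycle_arc_irr l).

Lemma ex2_ub (n : nat) (F D : digraph) :
  #|D| = n -> free F D -> sum_sq_outdeg D <= ex2 n F.
Proof.
move=> cardD freeD; move: cardD => /esym cardD; subst n.
pose A0 := [set p : 'I_#|D| * 'I_#|D| | arc (enum_val p.1) (enum_val p.2)].
have A0P : loopless A0 by apply/forallP=> v; rewrite inE /= arc_irr.
pose A : arc_set #|D| := exist _ A0 A0P.
have arcE u v : @arc (digraph_of A) u v = arc (enum_val u : D) (enum_val v).
  by rewrite /= inE.
have freeA : free F (digraph_of A).
  apply: contra freeD => /existsP[f /andP[/injectiveP f_inj /forallP f_arc]].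
  apply/existsP; exists [ffun x => (enum_val (f x) : D)]; apply/andP; split.
    by apply/injectiveP=> x y; rewrite !ffunE => /enum_val_inj /f_inj.
  apply/forallP=> u; apply/forallP=> v; rewrite !ffunE -arcE.
  exact: (forallP (f_arc u)).
suff -> : sum_sq_outdeg D = sum_sq_outdeg (digraph_of A).
  exact: (bigmax_sup A).
rewrite /sum_sq_outdeg (reindex (fun i : 'I_#|D| => (enum_val i : D))) /=; last first.
  by apply: onW_bij; exact: enum_val_bij.
apply: eq_bigr => i _; congr (_ ^ 2); rewrite /outdeg.
rewrite -(card_imset _ (@enum_val_inj _ (mem D))); congr #|pred_of_set _|.
apply/setP=> w; rewrite inE; apply/idP/imsetP => [iw|[j]].
  by exists (enum_rank w); rewrite ?enum_rankK // inE arcE enum_rankK.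
by rewrite inE arcE => ij ->.
Qed.

Lemma ex2_attained (n : nat) (F D : digraph) :
  #|D| = n -> free F D ->
  exists E : digraph, [/\ #|E| = n, free F E & sum_sq_outdeg E = ex2 n F].
Proof.
move=> cardD freeD; case: (posnP (ex2 n F)) => [ex0|ex_gt0].
  exists D; split=> //; apply/eqP; rewrite ex0 -leqn0 -ex0.
  exact: ex2_ub.
have [/eqP noA|] := posnP #|[pred A : arc_set n | free F (digraph_of A)]|.
  by move: ex_gt0; rewrite /ex2 big_pred0 // => A; have /eqP/card0_eq/(_ A) := noA.
move=> hasA.
have [A freeA exA] := eq_bigmax_cond (fun A => sum_sq_outdeg (@digraph_of n A)) hasA.
by exists (digraph_of A); split=> //; rewrite ?card_ord.
Qed.

(* Main.v *)
Require Import Defs.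
From mathcomp Require Import all_boot all_order all_algebra.
From mathcomp Require Import zify lra.

(** Put [k = l - 1]. In a digraph without a directed (k+1)-cycle, each vertex
    outside a k-cycle [c] is joined to [c] by at most [k] arcs; removing
    k-cycles greedily, and using induction on [k] when none is left, shows that
    [s] vertices span at most [\sum_(i < s) (i + i %% k)] arcs. Hence the [s]
    largest out-degrees sum to at most [\sum_(i < s) (n - 1 - k * (i %/ k))],
    which is attained for every [s] at once by the transitive arrangement of
    complete digraphs on [k] vertices, the last one being possibly smaller.
    Majorization then bounds the sum of the squares. *)

Set Implicit Arguments.
Unset Strict Implicit.
Unset Printing Implicit Defensive.

(** * Sums of residues and majorization *)

Lemma sum_modn_window (k m : nat) :
  \sum_(m <= i < m + k) i %% k = \sum_(0 <= i < k) i.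
Proof.
elim: m => [|m IHm].
  by rewrite add0n; apply: eq_big_nat => i /andP[_ ltik]; rewrite modn_small.
case: k IHm => [|k] IHm; first by rewrite !addn0 !big_geq.
rewrite -IHm addSn big_nat_recr /=; last by lia.
by rewrite modnDr [RHS]big_ltn 1?addnC //; lia.
Qed.

(** Induction by dropping the last [k] terms. On the left they are a full period, with sum
    [0 + ... + (k - 1)]. On the right they are a period of length [k + 1] short of one residue,
    which is at most [k], so their sum is no smaller. *)
Lemma leq_sum_modn (k n : nat) : 0 < k ->
  \sum_(0 <= i < n) i %% k <= \sum_(0 <= i < n) i %% k.+1.
Proof.
move=> k_gt0; have [m] := ubnP n; elim: m n => // m IHm n lenm.
have [lenk|ltkn] := leqP n k.
  by apply: eq_leq; apply: eq_big_nat => i ltin; rewrite !modn_small; lia.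
have /IHm IHp : n - k < m by lia.
move: IHp; rewrite -{3 4}(subnK (ltnW ltkn)); move: (n - k) => p IHp.
rewrite !(@big_cat_nat _ _ _ p 0 (p + k)) ?leq_addr //= leq_add //.
rewrite sum_modn_window.
have := sum_modn_window k.+1 p; rewrite addnS !big_nat_recr ?leq_addr //=.
have := ltn_pmod (p + k) (ltn0Sn k); lia.
Qed.

(* Abel summation: [a] is a nonnegative combination of indicators of initial
   segments. *)
Lemma leq_sum_mul_nonincr (n : nat) (a b c : nat -> nat) :
  (forall i j, i <= j < n -> a j <= a i) ->
  (forall m, m <= n -> \sum_(0 <= i < m) b i <= \sum_(0 <= i < m) c i) ->
  \sum_(0 <= i < n) a i * b i <= \sum_(0 <= i < n) a i * c i.
Proof.
elim: n a => [|n IHn] a a_decr le_bc; first by rewrite !big_geq.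
have split_a d : \sum_(0 <= i < n.+1) a i * d i =
    a n * \sum_(0 <= i < n.+1) d i + \sum_(0 <= i < n) (a i - a n) * d i.
  rewrite !big_nat_recr //= mulnDr addnAC big_distrr -big_split /=.
  congr (_ + _); apply: eq_big_nat => i ltin.
  by rewrite -mulnDl subnKC // a_decr; lia.
rewrite !split_a leq_add ?leq_mul ?le_bc ?IHn // => [i j leij|m lemn].
  by rewrite leq_sub2r // a_decr; lia.
by rewrite le_bc // ltnW.
Qed.

(** Abel summation bounds the sum of [a i ^ 2] by that of [a i * b i]; then
    [2 * (a i * b i) <= a i ^ 2 + b i ^ 2] finishes. *)
Lemma leq_sum_sqr_nonincr (n : nat) (a b : nat -> nat) :
  (forall i j, i <= j < n -> a j <= a i) ->
  (forall m, m <= n -> \sum_(0 <= i < m) a i <= \sum_(0 <= i < m) b i) ->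
  \sum_(0 <= i < n) a i ^ 2 <= \sum_(0 <= i < n) b i ^ 2.
Proof.
move=> a_decr le_ab; have := leq_sum_mul_nonincr a_decr le_ab.
have : \sum_(0 <= i < n) 2 * (a i * b i)
       <= \sum_(0 <= i < n) (a i ^ 2 + b i ^ 2).
  by apply: leq_sum => i _; apply: nat_Cauchy.
rewrite -big_distrr big_split /=.
under [\sum_(0 <= i < n) a i * a i]eq_bigr do rewrite mulnn.
lia.
Qed.

(** * Arcs and out-degrees without a directed (k+1)-cycle *)

Section Cycles.

Variables (T : finType) (e : rel T).

Definition num_arcs (S : {set T}) : nat := \sum_(x in S) \sum_(y in S) e x y.

Definition has_cycle (m : nat) (S : {set T}) : bool :=
  [exists c : m.-tuple T, [&& uniq c, cycle e c & all (mem S) c]].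

Lemma has_cycleI (S : {set T}) (c : seq T) :
  uniq c -> cycle e c -> {subset c <= S} -> has_cycle (size c) S.
Proof.
by move=> Uc Cc /allP cS; apply/existsP; exists (in_tuple c); rewrite Uc Cc.
Qed.

Lemma has_cycleS (m : nat) (A B : {set T}) :
  A \subset B -> has_cycle m A -> has_cycle m B.
Proof.
move=> /subsetP sAB /existsP[c /and3P[Uc Cc /allP cA]].
by apply/existsP; exists c; rewrite Uc Cc; apply/allP => x /cA/sAB.
Qed.

(* Otherwise [v] could be inserted between some [x] in [c] and its successor.
   A single vertex counts as a closed walk of length 1. *)
Lemma arcs_to_cycle (S : {set T}) (c : seq T) (v : T) :
  ~~ has_cycle (size c).+1 S -> uniq c -> (size c == 1) || cycle e c ->
  {subset c <= S} -> v \in S -> v \notin c ->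
  \sum_(x <- c) (e v x + e x v) <= size c.
Proof.
move=> noC Uc Cc cS vS vc.
have next_inj : injective (next c).
  by apply: (can_inj (g := prev c)) => x; apply: prev_next.
have next_perm : perm_eq (map (next c) c) c.
  apply: uniq_perm => // [|x]; first by rewrite map_inj_uniq.
  apply/mapP/idP => [[y yc ->]|xc]; first by rewrite mem_next.
  by exists (prev c x); rewrite ?mem_prev ?next_prev.
(* Reindexing by [next c] pairs the arc from [v] to [next c x] with the arc from [x] to [v]; having
   both would insert [v] after [x]. *)
rewrite big_split /= -(perm_big _ next_perm) big_map -big_split /=.
rewrite -sum1_size big_seq [X in _ <= X]big_seq; apply: leq_sum => x xc.
suff : ~~ (e v (next c x) && e x v) by case: (e v _); case: (e x v).
apply: contra noC => /andP[evx exv].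
have [i p def_c] := rot_to xc.
rewrite -(size_rot i) def_c -[(size _).+1]/(size [:: x, v & p]).
have mem_p y : y \in x :: p -> y \in c by rewrite -def_c mem_rot.
have Up : uniq (x :: p) by rewrite -def_c rot_uniq.
apply: has_cycleI.
- move: Up => /= /andP[xp ->]; rewrite !inE negb_or xp !andbT.
  apply/andP; split; first by apply: contraNneq vc => <-.
  by apply: contra vc => vp; rewrite mem_p // inE vp orbT.
- rewrite /= exv /=; move: evx; rewrite -(next_rot i Uc) def_c.
  case: p def_c {mem_p Up} => [|y p] def_c /=; rewrite eqxx ?andbT // => ->.
  move: Cc; rewrite -(size_rot i) def_c /= -(rot_cycle i) def_c /=.
  by case/andP.
- by move=> y; rewrite !inE orbCA => /orP[/eqP->//|yp]; rewrite cS ?mem_p ?inE.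
Qed.

Hypothesis e_irr : irreflexive e.

Lemma num_arcs_max (S : {set T}) : num_arcs S <= #|S| * (#|S| - 1).
Proof.
rewrite /num_arcs -sum_nat_const; apply: leq_sum => x xS.
rewrite (bigD1 x) //= e_irr add0n (cardsD1 x) xS addKn -sum1_card.
rewrite (eq_bigl (mem (S :\ x))) => [|y]; last by rewrite !inE andbC.
by apply: leq_sum => y _; apply: leq_b1.
Qed.

Lemma num_arcs_split (A S : {set T}) : A \subset S ->
  num_arcs S = num_arcs A + num_arcs (S :\: A)
               + \sum_(v in S :\: A) \sum_(x in A) (e v x + e x v).
Proof.
move=> sAS; have splitS (f : T -> nat) :
    \sum_(x in S) f x = \sum_(x in A) f x + \sum_(x in S :\: A) f x.
  by rewrite (big_setID A) /= (setIidPr sAS).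
rewrite /num_arcs splitS.
under eq_bigr do rewrite splitS.
under [X in _ + X = _]eq_bigr do rewrite splitS.
under [X in _ = _ + X]eq_bigr do rewrite big_split.
rewrite !big_split /= [X in _ + X + _ = _]exchange_big /=; lia.
Qed.

Lemma num_arcs_remove_cycle (S : {set T}) (c : seq T) :
  ~~ has_cycle (size c).+1 S -> uniq c -> (size c == 1) || cycle e c ->
  {subset c <= S} ->
  num_arcs S <= num_arcs (S :\: [set:: c])
                + size c * (size c - 1) + (#|S| - size c) * size c.
Proof.
move=> noC Uc Cc cS; pose A := [set:: c].
have sAS : A \subset S by apply/subsetP => x; rewrite inE => /cS.
have cardA : #|A| = size c by rewrite cardsE; apply/card_uniqP.
rewrite (num_arcs_split sAS) [num_arcs A + _]addnC -!addnA leq_add2l.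
have := num_arcs_max A; rewrite cardA => le_A; rewrite leq_add //.
have -> : #|S| - size c = #|S :\: A| by rewrite cardsD (setIidPr sAS) cardA.
rewrite -sum_nat_const; apply: leq_sum => v; rewrite !inE => /andP[vc vS].
rewrite (eq_bigl (mem c)) => [|x]; last by rewrite inE.
by rewrite -big_uniq // (arcs_to_cycle noC).
Qed.

(** The greedy removal shared by the base case and the inductive step on [k]: each set either offers
    a cycle to remove or satisfies the bound already. *)
Lemma num_arcs_cycle_ind (k : nat) : 0 < k ->
  (forall S : {set T}, ~~ has_cycle k.+1 S ->
     (exists c, [/\ size c = k, uniq c, (size c == 1) || cycle e c
                   & {subset c <= S}])
     \/ num_arcs S <= \sum_(0 <= i < #|S|) (i + i %% k)) ->
  forall S : {set T}, ~~ has_cycle k.+1 S ->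
    num_arcs S <= \sum_(0 <= i < #|S|) (i + i %% k).
Proof.
move=> k_gt0 exC S; have [m] := ubnP #|S|; elim: m S => // m IHm S ltSm noC.
have [[c [sz_c Uc Cc cS]]|//] := exC S noC.
have sAS : [set:: c] \subset S by apply/subsetP => x; rewrite inE => /cS.
have cardA : #|[set:: c]| = k by rewrite cardsE -sz_c; apply/card_uniqP.
have cardSA : #|S| = #|S :\: [set:: c]| + k.
  by rewrite -(cardsID [set:: c] S) (setIidPr sAS) cardA addnC.
have := num_arcs_remove_cycle _ Uc Cc cS; rewrite sz_c => /(_ noC).
move/leq_trans; apply.
have := IHm (S :\: [set:: c]); rewrite cardSA.
move: #|S :\: _| cardSA => p cardS.
have -> : ~~ has_cycle k.+1 (S :\: [set:: c]).
  by apply: contra noC; apply/has_cycleS/subsetDl.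
(* The last [k] terms sum to [p * k + k * (k - 1)], exactly the bound on the arcs lost with [c]. *)
move=> IHp; rewrite (@big_cat_nat _ _ _ p 0 (p + k)) ?leq_addr //=.
rewrite -addnA leq_add ?IHp //; first by lia.
rewrite big_split sum_modn_window /=.
have -> : \sum_(p <= i < p + k) i = p * k + \sum_(0 <= i < k) i.
  rewrite -{1}(add0n p) big_addn addKn big_split sum_nat_const_nat subn0 /=.
  by rewrite addnC mulnC.
have : \sum_(0 <= i < k) i + \sum_(0 <= i < k) i = k * (k - 1).
  by rewrite bin2_sum addnn -mul2n -mul_bin_diag bin1 subn1.
lia.
Qed.

(* Without a [k]-cycle the bound for [k - 1] applies, and it is stronger. *)
Lemma num_arcs_cycle_free (k : nat) (S : {set T}) : 0 < k ->
  ~~ has_cycle k.+1 S -> num_arcs S <= \sum_(0 <= i < #|S|) (i + i %% k).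
Proof.
case: k => // k _; elim: k S => [|k IHk]; apply: num_arcs_cycle_ind => // S noC.
  (* For blocks of size 1, any single vertex serves as the cycle to remove. *)
  have [->|[x xS]] := set_0Vmem S; first by right; rewrite /num_arcs big_set0.
  by left; exists [:: x]; split=> // y; rewrite inE => /eqP->.
have [/existsP[c /and3P[Uc Cc /allP cS]]|noC'] := boolP (has_cycle k.+2 S).
  by left; exists c; rewrite size_tuple Cc orbT; split.
right; apply: leq_trans (IHk S noC') _; rewrite !big_split leq_add2l.
exact: leq_sum_modn.
Qed.

(** Arcs inside [S] obey the previous bound; at most [#|S| * (#|T| - #|S|)] arcs leave [S]. *)
Lemma sum_outdeg_cycle_free (k : nat) (S : {set T}) : 0 < k ->
  ~~ has_cycle k.+1 S ->
  \sum_(x in S) #|[set y | e x y]|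
    <= \sum_(0 <= i < #|S|) (#|T| - 1 - k * (i %/ k)).
Proof.
move=> k_gt0 noC; have le_ST := max_card (mem S).
have -> : \sum_(x in S) #|[set y | e x y]| =
    num_arcs S + \sum_(x in S) \sum_(y in ~: S) e x y.
  rewrite -big_split; apply: eq_bigr => x _ /=.
  rewrite -sum1_card big_mkcond (bigID (mem S)) /=; congr (_ + _).
    by apply: eq_bigr => y _; rewrite !inE; case: e.
  by apply: eq_big => [y|y _]; rewrite !inE //; case: e.
have out_S : \sum_(x in S) \sum_(y in ~: S) e x y <= #|S| * (#|T| - #|S|).
  have -> : #|T| - #|S| = #|~: S| by rewrite -(cardsC S) addKn.
  rewrite -sum_nat_const; apply: leq_sum => x _.
  by rewrite -sum1_card; apply: leq_sum => y _; apply: leq_b1.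
have := num_arcs_cycle_free k_gt0 noC; move: {noC}#|S| le_ST out_S => s le_sT.
(* Both sides grow by the same amount from [s] to [s + 1], since [s = k * (s %/ k) + s %% k]. *)
have : \sum_(0 <= i < s) (#|T| - 1 - k * (i %/ k)) =
       \sum_(0 <= i < s) (i + i %% k) + s * (#|T| - s).
  elim: s le_sT => [|s IHs] le_sT; first by rewrite !big_geq.
  rewrite !big_nat_recr //= IHs 1?ltnW //; have := divn_eq s k.
  by rewrite -(subnK le_sT) mulnC; move: (#|T| - s.+1) (k * _) => t b; nia.
lia.
Qed.

(** With the vertices sorted by decreasing out-degree, each prefix is a set to which
    [sum_outdeg_cycle_free] applies, which gives the prefix bounds for majorization. *)
Lemma sum_sqr_outdeg_cycle_free (k : nat) : 0 < k -> ~~ has_cycle k.+1 setT ->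
  \sum_x #|[set y | e x y]| ^ 2
    <= \sum_(0 <= i < #|T|) (#|T| - 1 - k * (i %/ k)) ^ 2.
Proof.
move=> k_gt0 noC; pose d x := #|[set y | e x y]|.
have [x0 _|T0] := pickP T; last by rewrite big_pred0.
pose r x y := d y <= d x.
have r_total : total r by move=> x y; apply: leq_total.
have r_trans : transitive r by move=> y x z ryx rxz; apply: leq_trans rxz ryx.
pose s := sort r (enum T); pose a i := d (nth x0 s i).
have sz_s : size s = #|T| by rewrite size_sort cardE.
have Us : uniq s by rewrite sort_uniq enum_uniq.
have sum_s f : \sum_x f x = \sum_(x <- s) f x :> nat.
  by rewrite (perm_big _ (permEl (perm_sort r (enum T)))) big_enum.
rewrite sum_s (big_nth x0) sz_s.
apply: (leq_sum_sqr_nonincr (a := a)) => [i j /andP[leij ltjn]|m lemn].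
  by apply: (sorted_leq_nth r_trans) => //; rewrite ?inE ?sz_s ?sort_sorted //;
    [move=> x; apply: leqnn | lia].
pose S := [set:: take m s].
have cardS : #|S| = m.
  by rewrite cardsE (card_uniqP _) ?take_uniq // size_takel ?sz_s.
have noS : ~~ has_cycle k.+1 S by apply: contra noC; apply/has_cycleS/subsetT.
have := sum_outdeg_cycle_free k_gt0 noS; rewrite cardS; apply: leq_trans.
apply: eq_leq; rewrite (eq_bigl (mem (take m s))) => [|x]; last by rewrite inE.
rewrite -big_uniq ?take_uniq //= (big_nth x0) size_takel ?sz_s //.
by apply: eq_big_nat => i ltim; rewrite nth_take.
Qed.

End Cycles.

Lemma contains_dicycle (D : digraph) (l : nat) (S : {set D}) :
  1 < l -> has_cycle (@Defs.arc D) l S -> contains (dicycle l) D.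
Proof.
move=> l_gt1 /existsP[c /and3P[Uc Cc _]].
apply/existsP; exists [ffun i : 'I_l => tnth c i]; apply/andP; split.
  by apply/injectiveP => i j; rewrite !ffunE; apply/tuple_uniqP.
apply/forallP => i; apply/forallP => j; apply/implyP => /andP[_ /eqP->].
rewrite !ffunE; have := next_cycle Cc (mem_tnth i c).
have x0 := tnth c i; rewrite !(tnth_nth x0) next_nth mem_nth ?size_tuple //.
rewrite index_uniq ?size_tuple //=.
case: c Uc Cc => -[|y s] /= sz_s Us Cs; first by lia.
(* [next] reads the tail [s] at index [i] with default [y], so at the last index it wraps to the
   head, as [ordS] does. *)
have [lt_i1|ge_i1] := ltnP i.+1 l.
  by rewrite modn_small //= (set_nth_default x0) // -ltnS (eqP sz_s).
have -> : i.+1 = l by apply/eqP; rewrite eqn_leq ge_i1 ltn_ord.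
by rewrite modnn [in X in X -> _](nth_default y) // -ltnS (eqP sz_s).
Qed.

(** * The extremal digraph *)

Section ExtremalDigraph.

Variables n k : nat.

Definition block_arc (u v : 'I_n) : bool := (u != v) && (u %/ k <= v %/ k).

Lemma block_arc_irr : irreflexive block_arc.
Proof. by move=> u; rewrite /block_arc eqxx. Qed.

Definition block_digraph : digraph := Digraph block_arc_irr.

(* The block number cannot decrease along a closed walk, so a directed cycle
   stays in a single block, which has only [k] vertices. *)
Lemma block_digraph_free : 0 < k -> Defs.free (dicycle k.+1) block_digraph.
Proof.
move=> k_gt0; apply/existsP => -[f /andP[/injectiveP f_inj /forallP f_arc]].
pose b i := f i %/ k.
have b_step (i : 'I_k.+1) : b i <= b (ordS i).
  have := forallP (f_arc i) (ordS i); rewrite /= /dicycle_arc eqxx andbT.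
  have [<- //|_ /andP[]//] := eqVneq i (ordS i).
have b_iter m (i : 'I_k.+1) : b i <= b (iter m (@ordS k.+1) i).
  by elim: m => //= m IHm; apply: leq_trans IHm (b_step _).
have iter_val m (i : 'I_k.+1) : iter m (@ordS k.+1) i = (i + m) %% k.+1 :> nat.
  elim: m => [|m IHm] /=; first by rewrite addn0 modn_small.
  by rewrite IHm -addn1 modnDml addn1 addnS.
have b_le (i j : 'I_k.+1) : b i <= b j.
  (* The added [k.+1] keeps the subtraction from truncating and vanishes modulo [k.+1]. *)
  have -> : j = iter (j + k.+1 - i) (@ordS k.+1) i; last exact: b_iter.
  apply: val_inj; rewrite /= iter_val subnKC ?modnDr ?modn_small //.
  by rewrite (leq_trans (ltnW (ltn_ord i))) ?leq_addl.
have b_const i : b i = b ord0 by apply/eqP; rewrite eqn_leq !b_le.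
(* Within one block the residue modulo [k] determines the vertex, so [k + 1] vertices would inject
   into [k] residues. *)
pose g (i : 'I_k.+1) : 'I_k := Ordinal (ltn_pmod (f i) k_gt0).
have g_inj : injective g.
  move=> i j /(congr1 val) /= eq_mod; apply/f_inj/val_inj.
  rewrite /= (divn_eq (f i) k) (divn_eq (f j) k) eq_mod.
  by rewrite -/(b i) -/(b j) !b_const.
by have := leq_card g g_inj; rewrite !card_ord ltnn.
Qed.

(** The out-neighbours of [u] are all vertices from the start of its block onwards, except [u]. *)
Lemma outdeg_block_digraph (u : block_digraph) : 0 < k ->
  outdeg u = n - 1 - k * (u %/ k).
Proof.
move=> k_gt0; pose A := [set w : 'I_n | k * (u %/ k) <= w].
have uA : (u : 'I_n) \in A by rewrite inE mulnC leq_trunc_div.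
have -> : outdeg u = #|A :\ (u : 'I_n)|.
  apply: eq_card => w; rewrite !inE /= /block_arc eq_sym; congr (_ && _).
  by rewrite leq_divRL // mulnC.
have : #|A| = n - k * (u %/ k).
  rewrite -sum1_card (eq_bigl (fun w : 'I_n => k * (u %/ k) <= w)) => [|w].
    by rewrite -(big_geq_mkord _ _ xpredT (fun=> 1)) sum_nat_const_nat muln1.
  by rewrite inE.
by rewrite (cardsD1 (u : 'I_n)) uA add1n subnAC => <-; rewrite subn1.
Qed.

End ExtremalDigraph.

(** * The extremal value and its closed forms *)

Definition sum_sqr_blocks (k n : nat) : nat :=
  \sum_(0 <= i < n) (n - 1 - k * (i %/ k)) ^ 2.

Lemma ex2_dicycle (n k : nat) : 0 < k ->
  ex2 n (dicycle k.+1) = sum_sqr_blocks k n.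
Proof.
move=> k_gt0; apply/eqP; rewrite eqn_leq; apply/andP; split.
  apply/bigmax_leqP => A freeA.
  have noC : ~~ has_cycle (@Defs.arc (digraph_of A)) k.+1 setT.
    by apply: contra freeA; apply: contains_dicycle.
  have := sum_sqr_outdeg_cycle_free (@arc_irr (digraph_of A)) k_gt0 noC.
  by rewrite card_ord.
have /(_ n (card_ord n)) := ex2_ub _ (block_digraph_free n k_gt0).
apply: leq_trans; apply: eq_leq; rewrite /sum_sqr_blocks big_mkord.
by apply: eq_bigr => u _; rewrite outdeg_block_digraph.
Qed.

Lemma sum_sqr_blocks_small (k n : nat) : n <= k ->
  sum_sqr_blocks k n = n * (n - 1) ^ 2.
Proof.
move=> lenk; rewrite -{2}[n]subn0 -sum_nat_const_nat.
apply: eq_big_nat => i ltin.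
by rewrite divn_small ?muln0 ?subn0 //; lia.
Qed.

(** The vertices of the first block reach all others; removing this block leaves the same structure
    on [n] vertices. *)
Lemma sum_sqr_blocksD (k n : nat) : 0 < k ->
  sum_sqr_blocks k (k + n) = k * (k + n - 1) ^ 2 + sum_sqr_blocks k n.
Proof.
move=> k_gt0; rewrite /sum_sqr_blocks (@big_cat_nat _ _ _ k) ?leq_addr //=.
congr (_ + _).
  transitivity (\sum_(0 <= i < k) (k + n - 1) ^ 2); last first.
    by rewrite sum_nat_const_nat subn0.
  apply: eq_big_nat => i ltik.
  by rewrite divn_small ?muln0 ?subn0.
rewrite -{1}[k]add0n big_addn addKn; apply: eq_bigr => i _.
rewrite divnDr // divnn k_gt0 mulnDr muln1.
by congr (_ ^ 2); move: (k * _) => b; lia.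
Qed.

Lemma sum_sqr_blocksE (k q r : nat) : r < k ->
  sum_sqr_blocks k (k * q + r) =
  \sum_(1 <= i < q.+1) k * (k * (q - i + 1) - 1 + r) ^ 2
  + (if 0 < r then r * (r - 1) ^ 2 else 0).
Proof.
move=> ltrk; elim: q => [|q IHq].
  rewrite muln0 big_geq // sum_sqr_blocks_small ?(ltnW ltrk) //.
  by case: r ltrk.
have k_gt0 : 0 < k by lia.
(* The first block is the term [i = 1]; shifting the index turns the other terms into the sum for
   [q]. *)
rewrite [in RHS]big_ltn // big_add1 /= mulnS -addnA sum_sqr_blocksD //.
rewrite IHq addnA.
congr (_ * _ ^ 2 + _ + _); rewrite subn1 addn1 //= mulnS; lia.
Qed.

(** Stated without subtraction or division to stay in [nat]; the induction removes one block of two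
    vertices at a time. *)
Lemma sum_sqr_blocks2 (n : nat) : 3 * sum_sqr_blocks 2 n + n = n ^ 3.
Proof.
have [m] := ubnP n; elim: m n => // m IHm [|[|n]] ltnm.
- by rewrite sum_sqr_blocks_small.
- by rewrite sum_sqr_blocks_small.
have := IHm n (ltnW ltnm); rewrite -[n.+2]/(2 + n) sum_sqr_blocksD //.
rewrite add2n subn1 /= !expnS !expn0; nia.
Qed.

Theorem corollary3p3 (n : nat) (hn : 1 <= n) :
  (forall l q r : nat, 3 <= l -> n = (l - 1) * q + r -> r < l - 1 ->
     ex2 n (dicycle l) =
       \sum_(1 <= i < q.+1) (l - 1) * ((l - 1) * (q - i + 1) - 1 + r) ^ 2
       + (if 0 < r then r * (r - 1) ^ 2 else 0))
  /\
  ((ex2 n (dicycle 3))%:R = n%:R * (n%:R ^+ 2 - 1) / 3%:R :> rat)%R.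
Proof.
split=> [l q r l_ge3 -> ltr|].
  by rewrite -sum_sqr_blocksE // -ex2_dicycle ?subn1 ?prednK; lia.
rewrite ex2_dicycle //; have := sum_sqr_blocks2 n.
move: (sum_sqr_blocks 2 n) => s /(congr1 (fun m => m%:R : rat)%R).
rewrite GRing.natrD GRing.natrM GRing.natrX => def_s.
lra.
Qed.
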